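(* For any $k\ge 1$, $$\Phi_{[k]}(x)=\frac{1}{4t^3U_k^2(t)}\sum_{i=1}^{k-2}\frac{\sum_{j=1}^{k-i}U_j^2(t)-1}{U_{k-i}(t)\,U_{k-i+1}(t)},\qquad t=\frac{1}{2\sqrt{x}}.$$
   Context: $\mathfrak{S}_n$ is the set of permutations of $\{1,\dots,n\}$ in one-line notation. An occurrence of a pattern $\tau\in\mathfrak{S}_k$ in $\pi\in\mathfrak{S}_n$ is a subsequence $(\pi_{i_1},\dots,\pi_{i_k})$ with $i_1<\dots<i_k$ that is order-isomorphic to $\tau$; $\pi$ contains $\tau$ exactly once if there is exactly one occurrence of $\tau$ in $\pi$. $[k]$ denotes the identity pattern $(1,2,\dots,k)\in\mathfrak{S}_k$. $\Phi_\tau(x)=\sum_{n\ge 0}\varphi_\tau(n)x^n$, where $\varphi_\tau(n)$ is the number of permutations in $\mathfrak{S}_n$ that contain $132$ exactly once and also contain $\tau$ exactly once. $U_r$ is the Chebyshev polynomial of the second kind, $U_r(\cos\theta)=\frac{\sin (r+1)\theta}{\sin\theta}$, equivalently $U_0(y)=1$, $U_1(y)=2y$, $U_r(y)=2yU_{r-1}(y)-U_{r-2}(y)$. Empty sums are $0$. In the numerator, $\sum_{j=1}^{k-i}U_j^2(t)-1$ means $\bigl(\sum_{j=1}^{k-i}U_j^2(t)\bigr)-1$. With $t=\frac{1}{2\sqrt x}$ the right-hand side is a rational function of $x$, and the identity is an identity of formal power series in $x$. *)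

(* Defs.v *)
From HB Require Import structures.
From mathcomp Require Import all_boot all_order all_fingroup all_algebra.

Set Implicit Arguments.
Unset Strict Implicit.
Unset Printing Implicit Defensive.

Import Order.TTheory GRing.Theory Num.Theory.
Local Open Scope ring_scope.

(* Permutations of {1, ..., n} are elements of 'S_n: positions and values are
   both shifted down by one.  An occurrence is given by its increasing map of
   positions i_1 < ... < i_k; as p is injective, distinct position maps give
   distinct subsequences. *)
Definition is_occurrence (k n : nat) (tau : 'S_k) (p : 'S_n)
    (f : {ffun 'I_k -> 'I_n}) : bool :=
  [forall a : 'I_k, forall b : 'I_k, (a < b)%N ==> (f a < f b)%N] &&
  [forall a : 'I_k, forall b : 'I_k, (p (f a) < p (f b))%N == (tau a < tau b)%N].

Definition occurrences (k n : nat) (tau : 'S_k) (p : 'S_n) :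
    {set {ffun 'I_k -> 'I_n}} :=
  [set f | is_occurrence tau p f].

Definition contains_once (k n : nat) (tau : 'S_k) (p : 'S_n) : bool :=
  #|occurrences tau p| == 1%N.

(* The pattern 132, i.e. 0 |-> 0, 1 |-> 2, 2 |-> 1. *)
Definition pat132 : 'S_3 := tperm (inord 1) (inord 2).

Definition idpat (k : nat) : 'S_k := 1%g.

Definition phi (k : nat) (tau : 'S_k) (n : nat) : nat :=
  #|[set p : 'S_n | contains_once pat132 p && contains_once tau p]|.

Fixpoint chebU (R : nzRingType) (r : nat) {struct r} : {poly R} :=
  match r with
  | 0 => 1
  | r1.+1 => match r1 with
             | 0 => 2%:R *: 'X
             | r2.+1 => 2%:R *: 'X * chebU R r1 - chebU R r2
             end
  end.
Arguments chebU {R} r.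

(* Q(s), where the variable s plays the role of sqrt x. *)
Notation ratfun := {fraction {poly rat}}.

Definition sqrtx : ratfun := tofrac 'X.

Definition tcheb : ratfun := (2%:R * sqrtx)^-1.

(* p(x), where x = s^2. *)
Definition poly_in_x (p : {poly rat}) : ratfun := tofrac (p \Po 'X^2).

(* F is a rational function P(x) / Q(x) of x = s^2 with Q(0) <> 0, so that it
   has a (unique) expansion in Q[[x]], and this expansion is sum_n a_n x^n:
   Q(x) * (sum_n a_n x^n) = P(x), coefficient by coefficient. *)
Definition has_expansion (F : ratfun) (a : nat -> rat) : Prop :=
  exists P Q : {poly rat},
    [/\ Q`_0 != 0,
        F = poly_in_x P / poly_in_x Q
      & forall n : nat, \sum_(i < n.+1) Q`_i * a (n - i)%N = P`_n].

(* Main.v *)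
(** In a permutation [L n R] with top letter [n], every ascent from a letter of
    [L] to a letter of [R] creates an occurrence of 132.  If 132 occurs at most
    once, then either all letters of [L] exceed those of [R], or there is exactly
    one such ascent: it goes from the last letter of [L] to the maximum of [R],
    and removing that last letter leaves two 132-avoiding words, the left one
    above the right one.  In both cases, if [k >= 3], the increasing subsequences of
    length [k] split into those of the two parts plus those of length [k - 1] of the left
    part.  This yields convolution recurrences in [k] for the four generating
    functions (132 absent or once, [k] absent or once); after multiplication by
    Chebyshev polynomials they are solved by induction on [k] with the Cassini
    identity [V_k V_(k+2) = V_(k+1)^2 - x^(k+1)], where
    [V_r(x) = x^(r/2) U_r(1/(2 sqrt x))]. *)
Require Import Defs.
From HB Require Import structures.
From mathcomp Require Import all_boot all_order all_fingroup all_algebra.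
From mathcomp Require Import zify ring.
Set Implicit Arguments.
Unset Strict Implicit.
Unset Printing Implicit Defensive.
Import Order.TTheory GRing.Theory Num.Theory.
Local Open Scope nat_scope.

(** * Subsequences of a word and how to count them *)

(** One entry for each set of positions, so that counting over this list counts occurrences. *)
Fixpoint subseqs (T : Type) (s : seq T) : seq (seq T) :=
  if s is x :: s' then map (cons x) (subseqs s') ++ subseqs s' else [:: [::]].

Lemma mem_subseqs (T : eqType) (s t : seq T) : (t \in subseqs s) = subseq t s.
Proof.
elim: s t => [|x s IHs] t /=; first by rewrite inE; case: t.
rewrite mem_cat; case: t => [|y t]; first by rewrite IHs sub0seq orbT.
case: eqP => [->|neq_yx].
  rewrite mem_map ?IHs; last by move=> ? ? [].
  by apply/orb_idr => /cons_subseq.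
rewrite IHs; case: mapP => // -[u _ []]; by [].
Qed.

Lemma subseqs_uniq (T : eqType) (s : seq T) : uniq s -> uniq (subseqs s).
Proof.
elim: s => //= x s IHs /andP[xNs /IHs us].
rewrite cat_uniq us map_inj_uniq ?us //=; last by move=> ? ? [].
rewrite andbT; apply/hasPn => t; rewrite mem_subseqs => ts.
apply/negP => /mapP[u _ def_t]; move: ts; rewrite def_t => /mem_subseq/(_ x).
by rewrite mem_head (negPf xNs) => /(_ isT).
Qed.

Lemma count_subseqs_cons (T : Type) (P : pred (seq T)) (x : T) (s : seq T) :
  count P (subseqs (x :: s)) =
  count (fun t => P (x :: t)) (subseqs s) + count P (subseqs s).
Proof. by rewrite /= count_cat count_map. Qed.

(** Source of the recursions on the first letter: in an increasing subsequence or a 132 the letters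
    after [x] all exceed [x], so the rest is counted in the filtered tail. *)
Lemma count_subseqs_all (T : Type) (Q : pred T) (P : pred (seq T)) (s : seq T) :
  count (fun t => all Q t && P t) (subseqs s) = count P (subseqs (filter Q s)).
Proof.
elim: s P => //= x s IHs P; rewrite count_cat count_map IHs.
rewrite (eq_count (a2 := fun t => Q x && (all Q t && P (x :: t)))); last first.
  by move=> t /=; rewrite andbA.
by case: (Q x) => /=; rewrite ?count_cat ?count_map ?IHs // count_pred0.
Qed.

Lemma count_subseqs_nil (T : Type) (s : seq T) : count (@nilp T) (subseqs s) = 1.
Proof. by elim: s => //= x s IHs; rewrite count_cat count_map IHs count_pred0. Qed.

Lemma count_subseqs_gt1 (T : eqType) (P : pred (seq T)) (s t u : seq T) :
  t != u -> subseq t s -> subseq u s -> P t -> P u -> 1 < count P (subseqs s).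
Proof.
move=> neq_tu; rewrite -!mem_subseqs => ts us Pt Pu; rewrite -size_filter.
apply: (@uniq_leq_size _ [:: t; u]); first by rewrite /= inE neq_tu.
by move=> v; rewrite !inE mem_filter => /orP[]/eqP->; apply/andP.
Qed.

(** * Increasing subsequences, inversions and occurrences of 132 in a word *)

Definition inc (k : nat) (s : seq nat) : nat :=
  count (fun t => (size t == k) && sorted ltn t) (subseqs s).

(** Inversions at any distance, that is, occurrences of 21: what an occurrence of 132 leaves once
    its first letter is removed. *)
Definition desc (s : seq nat) : nat :=
  count (fun t => if t is [:: y; z] then z < y else false) (subseqs s).

Definition n132 (s : seq nat) : nat :=
  count (fun t => if t is [:: x; y; z] then x < z < y else false) (subseqs s).

Lemma inc0 s : inc 0 s = 1.
Proof.
by rewrite -(count_subseqs_nil s) /inc; apply: eq_count => -[].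
Qed.

Lemma inc_nil k : inc k.+1 [::] = 0.
Proof. by []. Qed.

Lemma inc_cons k x s :
  inc k.+1 (x :: s) = inc k (filter (ltn x) s) + inc k.+1 s.
Proof.
rewrite /inc count_subseqs_cons -[in RHS]count_subseqs_all; congr addn.
apply: eq_count => t /=; rewrite eqSS path_sortedE; last exact: ltn_trans.
by rewrite andbCA.
Qed.

Lemma inc1 s : inc 1 s = size s.
Proof. by elim: s => // x s IHs; rewrite inc_cons inc0 IHs. Qed.

Lemma desc_cons y s : desc (y :: s) = count (gtn y) s + desc s.
Proof.
rewrite /desc count_subseqs_cons; congr addn; elim: s => // z s IHs.
rewrite count_subseqs_cons IHs /=; congr addn.
case: (ltnP z y) => [zy|yz] /=.
  by rewrite -[RHS](count_subseqs_nil s); apply: eq_count => -[|].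
by rewrite -[RHS](count_pred0 (subseqs s)); apply: eq_count => -[|].
Qed.

Lemma n132_cons x s : n132 (x :: s) = desc (filter (ltn x) s) + n132 s.
Proof.
rewrite /n132 /desc count_subseqs_cons -[in RHS]count_subseqs_all; congr addn.
apply: eq_count => -[|y [|z [|w t]]] //=; rewrite ?andbF ?andbT //.
by apply/idP/idP; lia.
Qed.

Lemma filter_ltn_homo (f : nat -> nat) x s :
  {mono f : x y / x < y} -> filter (ltn (f x)) (map f s) = map f (filter (ltn x) s).
Proof.
by move=> fM; rewrite filter_map; congr map; apply: eq_filter => y /=; rewrite fM.
Qed.

Lemma inc_map (f : nat -> nat) k s : {mono f : x y / x < y} -> inc k (map f s) = inc k s.
Proof.
move=> fM; elim: k s => [|k IHk] s; first by rewrite !inc0.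
by elim: s => // x s IHs; rewrite map_cons !inc_cons IHs filter_ltn_homo // IHk.
Qed.

Lemma desc_map (f : nat -> nat) s : {mono f : x y / x < y} -> desc (map f s) = desc s.
Proof.
move=> fM; elim: s => // x s IHs; rewrite map_cons !desc_cons IHs count_map.
by congr addn; apply: eq_count => y /=; rewrite fM.
Qed.

Lemma n132_map (f : nat -> nat) s : {mono f : x y / x < y} -> n132 (map f s) = n132 s.
Proof.
move=> fM; elim: s => // x s IHs.
by rewrite map_cons !n132_cons IHs filter_ltn_homo // desc_map.
Qed.

(** Removing the first or the second letter of the longer subsequence gives two different shorter
    ones. Hence at most one occurrence of length [k.+1] excludes length [k.+2]. *)
Lemma inc_gt1 k s : 0 < inc k.+2 s -> 1 < inc k.+1 s.
Proof.
rewrite -has_count => /hasP[[|x [|y t]]]; rewrite mem_subseqs //= => sub_s.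
rewrite !eqSS => /andP[szt /andP[xy yt]].
apply: (@count_subseqs_gt1 _ _ _ (x :: t) (y :: t)) => /=.
- by rewrite eqseq_cons eqxx andbT; lia.
- by apply: subseq_trans sub_s; rewrite /= eqxx; apply: subseq_cons.
- by apply: subseq_trans sub_s; apply: subseq_cons.
- rewrite eqSS szt /=; move: yt; rewrite !path_sortedE; try exact: ltn_trans.
  case/andP=> /allP yt ->; rewrite andbT; apply/allP => z /yt /=; exact: ltn_trans.
- by rewrite eqSS szt.
Qed.

(** An occurrence [x y z] of 132 contains the two ascents [x y] and [x z]. This settles the patterns
    of length 1 and 2, where the recurrences start. *)
Lemma inc12_gt1 k s : 0 < n132 s -> (k == 1) || (k == 2) -> 1 < inc k s.
Proof.
rewrite -has_count => /hasP[[|x [|y [|z [|? ?]]]]]; rewrite mem_subseqs // => sub_s.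
move=> xzy; have xy : [:: x; y] != [:: x; z].
  by rewrite eqseq_cons eqxx eqseq_cons eqxx andbT /=; lia.
have i2 : 1 < inc 2 s.
  apply: (count_subseqs_gt1 xy) => /=; try lia.
  - by apply: subseq_trans sub_s; rewrite /= !eqxx.
  - apply: subseq_trans sub_s; rewrite /= !eqxx; case: eqP => //; by rewrite ?eqxx.
case/orP=> /eqP-> //; apply: inc_gt1; exact: ltnW.
Qed.

(* Seen from [L], the word [M] reduces to its single larger letter [n]. *)
Lemma inc_top k n L M : {in L, forall x, filter (ltn x) M = [:: n]} ->
  inc k.+2 (L ++ M) = inc k.+2 L + inc k.+1 L + inc k.+2 M.
Proof.
elim: k L M => [|k IHk] L M; elim: L => [|x L IHL] H //; rewrite cat_cons !inc_cons.
- rewrite IHL; last by move=> y yL; apply: H; rewrite inE yL orbT.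
  rewrite !inc1 filter_cat H ?mem_head // size_cat inc0 /=; lia.
- rewrite IHL; last by move=> y yL; apply: H; rewrite inE yL orbT.
  (* After the first letter [x] only [n] is left of [M], so the induction hypothesis is applied to
     [[:: n]], which has no increasing subsequence of length [k.+2]. *)
  have -> : inc k.+2 (filter (ltn x) (L ++ M)) =
            inc k.+2 (filter (ltn x) L) + inc k.+1 (filter (ltn x) L).
    rewrite filter_cat H ?mem_head // IHk.
    + by rewrite addnC !inc_cons /= ?inc_nil.
    + move=> y; rewrite mem_filter => /andP[xy yL] /=.
      have := H y; rewrite inE yL orbT => /(_ isT) defM.
      have : n \in filter (ltn y) M by rewrite defM mem_head.
      by rewrite mem_filter => /andP[/= -> _].
  lia.
Qed.

Lemma desc_rcons_max s n : all (gtn n) s -> desc (rcons s n) = desc s.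
Proof.
elim: s => //= x s IHs /andP[xn /IHs sn]; rewrite !desc_cons sn -cats1 count_cat /=.
by rewrite addn0; lia.
Qed.

(** After a first letter in [L], the larger letters that follow are letters of [L] and then [n].
    Being last and largest, [n] takes part in no inversion, so no 132 crosses from [L] to [M]. *)
Lemma n132_top n L M : {in L, forall x, filter (ltn x) M = [:: n]} ->
  n132 (L ++ M) = n132 L + n132 M.
Proof.
elim: L => [|x L IHL] H //; rewrite cat_cons !n132_cons IHL.
  rewrite filter_cat H ?mem_head // cats1 desc_rcons_max ?addnA //.
  apply/allP => y; rewrite mem_filter => /andP[xy yL] /=.
  have := H y; rewrite inE yL orbT => /(_ isT) defM.
  have : n \in filter (ltn y) M by rewrite defM mem_head.
  by rewrite mem_filter => /andP[/= -> _].
by move=> y yL; apply: H; rewrite inE yL orbT.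
Qed.

(** * Words of permutations and the two ways of joining them *)

(** One-line notation as a plain word with letters from 0; the length is read off the word, so
    cutting and gluing need no dependent types. *)
Definition pword (s : seq nat) : bool := perm_eq s (iota 0 (size s)).

Lemma pword_lt s x : pword s -> x \in s -> x < size s.
Proof. by move=> /perm_mem ->; rewrite mem_iota. Qed.

Lemma pword_uniq s : pword s -> uniq s.
Proof. by move=> /perm_uniq ->; apply: iota_uniq. Qed.

(* [L] and [R] are standardized: [join] puts all letters of [L] above those of [R];
   in [join_asc] the letter in front of the top one is smaller than exactly one
   further letter, the maximum of [R], which [bump] raises by one. *)
Definition join (L R : seq nat) : seq nat :=
  map (addn (size R)) L ++ (size L + size R) :: R.

Definition join_asc (L R : seq nat) : seq nat :=
  map (addn (size R).+1) L ++
  (size R).-1 :: (size L + size R).+1 :: map (bump (size R).-1) R.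

Lemma size_join L R : size (join L R) = (size L + size R).+1.
Proof. by rewrite size_cat size_map /= addnS. Qed.

Lemma size_join_asc L R : size (join_asc L R) = (size L + size R).+2.
Proof. by rewrite size_cat /= !size_map !addnS. Qed.

Lemma filter_ltn_max n s : all (gtn n) s -> filter (ltn n) s = [::].
Proof.
move=> /allP sn; apply/eqP; rewrite -(negbK (_ == _)) -has_filter; apply/hasPn => y /sn /=.
by rewrite -leqNgt => /ltnW.
Qed.

Lemma inc_max k n s : all (gtn n) s -> inc k.+2 (n :: s) = inc k.+2 s.
Proof. by move=> sn; rewrite inc_cons filter_ltn_max. Qed.

Lemma n132_max n s : all (gtn n) s -> n132 (n :: s) = n132 s.
Proof. by move=> sn; rewrite n132_cons filter_ltn_max. Qed.

Lemma addn_mono m : {mono addn m : x y / x < y}.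
Proof. by move=> x y; rewrite ltn_add2l. Qed.

Lemma bump_mono m : {mono bump m : x y / x < y}.
Proof. by move=> x y; rewrite /bump; lia. Qed.

Lemma bump_pred_leq m y : y < m -> bump m.-1 y <= m.
Proof. by rewrite /bump; lia. Qed.

Section Join.

Variables (L R : seq nat).
Hypotheses (wL : pword L) (wR : pword R).

Let join_filter :
  {in map (addn (size R)) L, forall x,
     filter (ltn x) ((size L + size R) :: R) = [:: size L + size R]}.
Proof.
move=> _ /mapP[x /(pword_lt wL) xL ->] /=; rewrite addnC ltn_add2r xL.
rewrite filter_ltn_max //; apply/allP => y /(pword_lt wR) /=; lia.
Qed.

Let join_max : all (gtn (size L + size R)) R.
Proof. by apply/allP => y /(pword_lt wR) /=; lia. Qed.

Lemma n132_join : n132 (join L R) = n132 L + n132 R.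
Proof. by rewrite (n132_top join_filter) n132_max // n132_map //; apply: addn_mono. Qed.

Lemma inc_join k : inc k.+2 (join L R) = inc k.+2 L + inc k.+1 L + inc k.+2 R.
Proof. by rewrite (inc_top _ join_filter) inc_max // !inc_map //; apply: addn_mono. Qed.

Lemma pword_join : pword (join L R).
Proof.
have pL : perm_eq (map (addn (size R)) L) (iota (size R) (size L)).
  by rewrite -{2}[size R]addn0 iotaDl perm_map.
rewrite /pword size_join -addn1 -addnA addnCA iotaD add0n iotaD /=.
have -> : size R + size L = size L + size R by rewrite addnC.
rewrite (perm_trans (y := iota (size R) (size L) ++ size L + size R :: iota 0 (size R))) //.
  by rewrite perm_cat // perm_cons.
by apply/seq.permP => P; rewrite !count_cat /=; lia.
Qed.

Hypothesis (R_gt0 : 0 < size R).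

Let join_asc_filter :
  {in map (addn (size R).+1) L, forall x,
     filter (ltn x) ((size R).-1 :: (size L + size R).+1 :: map (bump (size R).-1) R)
     = [:: (size L + size R).+1]}.
Proof.
move=> _ /mapP[x /(pword_lt wL) xL ->].
rewrite -cat1s filter_cat (_ : filter _ [:: _] = [::]); last by rewrite /= ifF //; lia.
rewrite /= ifT; last lia.
rewrite filter_ltn_max //; apply/allP => _ /mapP[y /(pword_lt wR)/bump_pred_leq yR ->] /=.
by rewrite ltn_addr // ltnS.
Qed.

Let join_asc_max : all (gtn (size L + size R).+1) (map (bump (size R).-1) R).
Proof.
by apply/allP => _ /mapP[y /(pword_lt wR)/bump_pred_leq yR ->] /=;
   rewrite ltnS (leq_trans yR) ?leq_addl.
Qed.

(** Bumping at [(size R).-1] moves the maximum of [R] and nothing else, so just one letter gets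
    above the one placed before the top. *)
Let join_asc_filter_low :
  filter (ltn (size R).-1) (map (bump (size R).-1) R) = [:: size R].
Proof.
rewrite filter_map.
have -> : filter (preim (bump (size R).-1) (ltn (size R).-1)) R = filter (pred1 (size R).-1) R.
  by apply: eq_in_filter => y /(pword_lt wR) /=; rewrite /bump; lia.
rewrite filter_pred1_uniq ?pword_uniq //; first by rewrite /= /bump leqnn add1n prednK.
by rewrite (perm_mem wR) mem_iota; lia.
Qed.

(** The additional occurrence consists of [(size R).-1], the top letter and the raised maximum
    [size R]. *)
Lemma n132_join_asc : n132 (join_asc L R) = (n132 L + n132 R).+1.
Proof.
rewrite (n132_top join_asc_filter) n132_map; last exact: addn_mono.
rewrite n132_cons n132_max // n132_map; last exact: bump_mono.
have -> : filter (ltn (size R).-1) ((size L + size R).+1 :: map (bump (size R).-1) R)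
          = [:: (size L + size R).+1; size R].
  by rewrite /= join_asc_filter_low ifT //; lia.
by rewrite !desc_cons (_ : desc [::] = 0) //=; lia.
Qed.

(** The letters after [(size R).-1] that exceed it are the top and [size R], in decreasing order. It
    therefore starts two increasing subsequences of length 2 and none of length 3, hence the index
    [k.+3]. *)
Lemma inc_join_asc k :
  inc k.+3 (join_asc L R) = inc k.+3 L + inc k.+2 L + inc k.+3 R.
Proof.
rewrite (inc_top _ join_asc_filter) !inc_map; try exact: addn_mono.
rewrite inc_cons inc_max // inc_map; last exact: bump_mono.
have -> : filter (ltn (size R).-1) ((size L + size R).+1 :: map (bump (size R).-1) R)
          = [:: (size L + size R).+1; size R].
  by rewrite /= join_asc_filter_low ifT //; lia.
by rewrite inc_max ?inc_cons ?inc_nil //=; lia.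
Qed.

Lemma pword_join_asc : pword (join_asc L R).
Proof.
rewrite /pword size_join_asc.
have pR : perm_eq (map (bump (size R).-1) R) (iota 0 (size R).-1 ++ [:: size R]).
  apply: (perm_trans (perm_map _ wR)).
  have -> : iota 0 (size R) = iota 0 (size R).-1 ++ [:: (size R).-1].
    by rewrite -{1}(prednK R_gt0) -addn1 iotaD.
  rewrite map_cat /= {2}/bump leqnn add1n prednK // perm_cat2r.
  rewrite (_ : map _ _ = iota 0 (size R).-1) //.
  rewrite -[RHS]map_id; apply/eq_in_map => x; rewrite mem_iota /bump; lia.
have pL : perm_eq (map (addn (size R).+1) L) (iota (size R).+1 (size L)).
  by rewrite -{2}[(size R).+1]addn0 iotaDl perm_map.
have -> : iota 0 (size L + size R).+2 =
  iota 0 (size R).-1 ++ [:: (size R).-1; size R] ++ iota (size R).+1 (size L) ++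
  [:: (size L + size R).+1].
  have -> : (size L + size R).+2 = (size R).-1 + (2 + (size L + 1)) by lia.
  rewrite iotaD add0n (iotaD _ 2) (iotaD _ (size L)) /= prednK //.
  have -> : (size R).-1 + 2 = (size R).+1 by lia.
  by rewrite addSn addnC.
rewrite /join_asc.
set M := (size L + size R).+1; set m := (size R).-1.
apply: (@perm_trans _ (iota (size R).+1 (size L) ++ m :: M :: (iota 0 m ++ [:: size R]))).
  by rewrite perm_cat // !perm_cons.
apply/seq.permP => P; rewrite !count_cat /= !count_cat /= ; lia.
Qed.

End Join.

(** * Decomposition of a word at its top letter *)

(** The sorted [R] followed by the sorted [L] is a sorted rearrangement of the interval, hence the
    interval itself; lengths locate the cut. *)
Lemma split_iota a L R : allrel (fun x y => y < x) L R ->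
  perm_eq (L ++ R) (iota a (size L + size R)) ->
  perm_eq R (iota a (size R)) /\ perm_eq L (iota (a + size R) (size L)).
Proof.
move=> /allrelP LR pLR.
have : sort leq R ++ sort leq L = iota a (size R) ++ iota (a + size R) (size L).
  rewrite -iotaD; apply: (sorted_eq leq_trans anti_leq).
  - rewrite (sorted_pairwise leq_trans) pairwise_cat -!(sorted_pairwise leq_trans).
    rewrite !(sort_sorted leq_total) !andbT; apply/allrelP => x y; rewrite !mem_sort => xR yL.
    exact: ltnW (LR _ _ yL xR).
  - exact: iota_sorted.
  - by rewrite addnC perm_catC (perm_trans _ pLR) // perm_cat // perm_sort.
move/eqP; rewrite eqseq_cat ?size_sort ?size_iota // => /andP[/eqP <- /eqP <-].
by rewrite ![perm_eq _ (sort _ _)]perm_sym !perm_sort.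
Qed.

Lemma pword_split s n : pword s -> size s = n.+1 ->
  exists L R, s = L ++ n :: R /\ perm_eq (L ++ R) (iota 0 n).
Proof.
rewrite /pword => ps sz; have : n \in s by rewrite (perm_mem ps) mem_iota sz add0n ltnSn.
move/splitPr => sP; case: sP ps sz => L R ps sz; exists L, R; split=> //.
rewrite -(perm_cons n) -(perm_catCA L [:: n] R) (perm_trans ps) // sz.
by rewrite -addn1 iotaD (perm_catC _ [:: _]).
Qed.

(** Induction on [L] from its front. A letter of [L] forms a 132 with [n] and each larger letter of
    [R], so at most one such pair exists, and it has to start at the last letter of [L]. *)
Lemma n132_split n L R : uniq (L ++ R) -> all (gtn n) (L ++ R) ->
  n132 (L ++ n :: R) <= 1 ->
  allrel (fun x y => y < x) L R \/
  exists L' l, [/\ L = rcons L' l, size (filter (ltn l) R) = 1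
                & allrel (fun x y => y < x) L' (l :: R)].
Proof.
have desc_gt u v x : x \in u -> has (gtn x) v -> desc v < desc (u ++ v).
  elim: u => // y u IHu; rewrite inE cat_cons desc_cons => /predU1P[->|xu] xv.
    rewrite count_cat; have : desc v <= desc (u ++ v).
      by elim: (u) => // z w IHw; rewrite cat_cons desc_cons; lia.
    by move: xv; rewrite has_count; lia.
  by have := IHu xu xv; lia.
have desc_n u v : all (gtn n) v -> size v <= desc (u ++ n :: v).
  move=> nv; elim: u => [|y u IHu]; rewrite ?cat_cons desc_cons; last lia.
  by move: nv; rewrite all_count => /eqP->; apply: leq_addr.
elim: L => [|x L IHL]; first by left; apply/allrelP.
rewrite cat_cons cons_uniq mem_cat negb_or => /andP[/andP[xL xR] uLR] /= /andP[xn nLR].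
rewrite n132_cons filter_cat /= ifT // => le1.
have nR : all (gtn n) (filter (ltn x) R).
  rewrite all_filter; move: nLR; rewrite all_cat => /andP[_].
  by apply: sub_all => y /= ->; apply: implybT.
have := desc_n (filter (ltn x) L) _ nR => le_szR.
have xRP : filter (ltn x) R = [::] -> {in R, forall y, y < x}.
  move=> R0 y yR; rewrite ltn_neqAle leqNgt; apply/andP; split.
    by apply: contraNneq xR => <-.
  apply/negP => xy; have : y \in filter (ltn x) R by rewrite mem_filter /= xy.
  by rewrite R0.
have [|LR|[L' [l [defL szR LR]]]] := IHL uLR nLR.
- exact: leq_trans (leq_addl _ _) le1.
- case: (posnP (size (filter (ltn x) R))) => [/size0nil/xRP xR0|R_gt0].
    by left; rewrite allrel_consl LR andbT; apply/allP.
  right; exists [::], x.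
  (* With [x < r] for some [r] in [R], a letter [y] after [x] in [L] would exceed [r], and [x y r]
     would be a second occurrence beside [x n r]. *)
  have L0 : L = [::].
    case: L {IHL} => // y L in LR le1 le_szR nLR xL uLR *.
    case defR: (filter (ltn x) R) R_gt0 => [//|r R'] _.
    have : r \in filter (ltn x) R by rewrite defR mem_head.
    rewrite mem_filter => /andP[/= xr rR].
    have ry : r < y by move/allrelP: LR; apply; rewrite ?mem_head.
    have := @desc_gt (filter (ltn x) (y :: L)) (n :: filter (ltn x) R) y.
    rewrite mem_filter mem_head /= (ltn_trans xr ry) /= defR /= ry orbT => /(_ isT isT).
    have := desc_n [::] _ nR; rewrite defR /=.
    by move: le1; rewrite defR /= (ltn_trans xr ry) /=; lia.
  split; rewrite ?L0 //.
  by move: le_szR le1; rewrite L0 /=; lia.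
(* The letter [l], the top [n] and the letter of [R] above [l] already form a 132, so [x] can have
   no larger letter in [R]. *)
have n132_gt0 : 0 < n132 (L ++ n :: R).
  rewrite defL cat_rcons; have : 0 < n132 (l :: n :: R).
    rewrite n132_cons /= ifT; last first.
      by move: nLR; rewrite defL cat_rcons all_cat /= => /and3P[].
    have nlR : all (gtn n) (filter (ltn l) R).
      apply/allP => y; rewrite mem_filter => /andP[_ yR].
      by move/allP: nLR; apply; rewrite mem_cat yR orbT.
    by have := desc_n [::] _ nlR; rewrite szR /=; lia.
  by move=> gt0; elim: (L') => // z w IHw; rewrite cat_cons n132_cons; lia.
have R0 : filter (ltn x) R = [::].
  have := leq_trans (leq_add le_szR n132_gt0) le1.
  by rewrite addn1 ltnS leqn0 => /eqP/size0nil.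
right; exists (x :: L'), l; split=> //; first by rewrite defL.
rewrite allrel_consl LR andbT /=; apply/andP; split; last by apply/allP/xRP.
case defR: (filter (ltn l) R) szR => [//|r R'] _.
have : r \in filter (ltn l) R by rewrite defR mem_head.
rewrite mem_filter => /andP[/= lr rR]; exact: ltn_trans lr (xRP R0 _ rR).
Qed.

Lemma pword_shift m L : perm_eq L (iota m (size L)) ->
  exists2 L0, pword L0 & L = map (addn m) L0.
Proof.
move=> pL; exists (map (subn^~ m) L).
  rewrite /pword size_map (perm_trans (perm_map _ pL)) //.
  rewrite -[X in iota X _]addn0 iotaDl -map_comp (_ : map _ _ = iota 0 (size L)) //.
  by rewrite -[RHS]map_id; apply/eq_in_map => x _ /=; rewrite addKn.
rewrite -map_comp -[LHS]map_id; apply/eq_in_map => x.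
by rewrite (perm_mem pL) mem_iota => /andP[mx _] /=; rewrite subnKC.
Qed.

Lemma join_surj n L R : allrel (fun x y => y < x) L R ->
  perm_eq (L ++ R) (iota 0 n) ->
  exists L0 R0, [/\ pword L0, pword R0 & L ++ n :: R = join L0 R0].
Proof.
move=> LR pLR; have def_n : n = size L + size R.
  by rewrite -size_cat (perm_size pLR) size_iota.
move: pLR; rewrite def_n => /(split_iota LR)[wR /pword_shift[L0 wL0 defL]].
by exists L0, R; split=> //; rewrite /join defL size_map.
Qed.

(** The letters of [l :: R] fill the interval from 0 to [size R]. Only one of them is above [l], so
    [l] is [(size R).-1], and [unbump] closes the gap that it leaves in [R]. *)
Lemma join_asc_surj n L l R : size (filter (ltn l) R) = 1 ->
  allrel (fun x y => y < x) L (l :: R) -> perm_eq (rcons L l ++ R) (iota 0 n) ->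
  exists L0 R0, [/\ pword L0, pword R0, 0 < size R0
                  & rcons L l ++ n :: R = join_asc L0 R0].
Proof.
rewrite size_filter !cat_rcons => szR LR pLR.
have def_n : n = size L + (size R).+1.
  by rewrite -[_.+1]/(size (l :: R)) -size_cat (perm_size pLR) size_iota.
move: pLR; rewrite {1}def_n => /(split_iota LR)[wR /pword_shift[L0 wL0 defL]].
have l_le : l < (size R).+1.
  by have := perm_mem wR l; rewrite mem_head mem_iota /= => <-.
have iotaE : iota 0 (size R).+1 = iota 0 l.+1 ++ iota l.+1 (size R - l).
  by rewrite -iotaD; congr iota; lia.
have szR_l : size R - l = 1.
  have szlR : count (ltn l) (l :: R) = 1 by rewrite /= ltnn.
  have /seq.permP/(_ (ltn l)) := wR.
  rewrite szlR -[size (l :: R)]/(size R).+1 iotaE count_cat.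
  rewrite (_ : count _ (iota 0 l.+1) = 0) => [|].
    rewrite add0n => ->; rewrite -{1}(size_iota l.+1 (size R - l)) -count_predT.
    by apply: eq_in_count => x; rewrite mem_iota => /andP[/= -> _].
  by apply/eqP; rewrite -leqn0 leqNgt -has_count; apply/hasPn => x; rewrite mem_iota /=; lia.
have pR : perm_eq R (iota 0 l ++ [:: l.+1]).
  rewrite -(perm_cons l) (perm_trans wR) // iotaE szR_l -addn1 iotaD -catA.
  by rewrite (perm_catCA _ [:: l]).
have lR : l = (size R).-1 by lia.
exists L0, (map (unbump l) R); split=> //; rewrite ?size_map; last 2 first.
- lia.
- rewrite /join_asc size_map -lR -map_comp defL; congr (_ ++ _ :: _ :: _).
    by rewrite def_n defL size_map addnS.
  rewrite -[LHS]map_id; apply/eq_in_map => x xR /=; rewrite unbumpK // inE.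
  by apply: contraTneq xR => ->; rewrite (perm_mem pR) mem_cat mem_iota inE; lia.
rewrite /pword size_map (perm_trans (perm_map _ pR)) // map_cat /=.
have -> : size R = l + 1 by lia.
rewrite iotaD /= /unbump ltnSn subn1 /= (_ : map _ _ = iota 0 l) //.
by rewrite -[RHS]map_id; apply/eq_in_map => x; rewrite mem_iota /=; lia.
Qed.

(** * Enumeration of words by pairs of shorter words *)

(** Grouping the pairs by the length [m] of the right word turns sums over them into
    convolutions. *)
Definition pword_pairs (n : nat) : seq (seq nat * seq nat) :=
  [seq p | m <- iota 0 n.+1,
           p <- [seq (L, R) | L <- permutations (iota 0 (n - m)),
                              R <- permutations (iota 0 m)]].

Lemma mem_pwords n s : (s \in permutations (iota 0 n)) = pword s && (size s == n).
Proof.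
rewrite mem_permutations; apply/idP/andP => [ps|[ps /eqP<-]] //.
by have := perm_size ps; rewrite size_iota => sz; rewrite /pword sz.
Qed.

Lemma mem_pword_pairs n L R :
  ((L, R) \in pword_pairs n) = [&& pword L, pword R & size L + size R == n].
Proof.
apply/idP/idP => [/allpairsPdep[m [p [mn pm defp]]]|/and3P[wL wR /eqP sz]].
  move: pm; rewrite -defp => /allpairsP[[L' R'] /= []]; rewrite !mem_pwords.
  move=> /andP[wL /eqP szL] /andP[wR /eqP szR] [-> ->].
  by rewrite wL wR szL szR /=; move: mn; rewrite mem_iota; lia.
apply/allpairsPdep; exists (size R), (L, R); split=> //; first by rewrite mem_iota; lia.
have szL : n - size R = size L by lia.
by apply/allpairsP; exists (L, R); rewrite !mem_pwords wL wR /= szL !eqxx.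
Qed.

Lemma pword_pairs_uniq n : uniq (pword_pairs n).
Proof.
apply: allpairs_uniq_dep; first exact: iota_uniq.
  move=> m _; apply: allpairs_uniq; try exact: permutations_uniq.
  by move=> [? ?] [? ?] _ _ [-> ->].
move=> _ _ /allpairsPdep[m1 [p1 [_ p1P ->]]] /allpairsPdep[m2 [p2 [_ p2P ->]]] /=.
move=> eq_p; move: p1P p2P; rewrite -eq_p => /allpairsP[[L R] /= [_ + ->]].
rewrite mem_pwords => /andP[_ /eqP<-] /allpairsP[[L' R'] /= [_ + [_ ->]]].
by rewrite mem_pwords => /andP[_ /eqP<-].
Qed.

Lemma sum_pword_pairs n (f g : seq nat -> nat) :
  \sum_(p <- pword_pairs n) f p.1 * g p.2 =
  \sum_(m < n.+1) (\sum_(L <- permutations (iota 0 (n - m))) f L)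
                * (\sum_(R <- permutations (iota 0 m)) g R).
Proof.
rewrite big_allpairs_dep /= -(big_mkord xpredT (fun m =>
  (\sum_(L <- permutations (iota 0 (n - m))) f L)
  * (\sum_(R <- permutations (iota 0 m)) g R))) /index_iota subn0.
apply: eq_bigr => m _; rewrite big_allpairs big_distrl /=.
by apply: eq_bigr => L _; rewrite big_distrr.
Qed.

Lemma index_cat_cons (n : nat) L R : n \notin L -> index n (L ++ n :: R) = size L.
Proof. by move=> nL; rewrite index_cat (negPf nL) /= eqxx addn0. Qed.

Lemma cat_cons_inj (n : nat) L R L' R' :
  n \notin L -> n \notin L' -> L ++ n :: R = L' ++ n :: R' -> L = L' /\ R = R'.
Proof.
move=> nL nL' eqLR; have := congr1 (index n) eqLR; rewrite !index_cat_cons // => szL.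
by move/eqP: eqLR; rewrite eqseq_cat // => /andP[/eqP-> /eqP[->]].
Qed.

Lemma top_notin_join L (R : seq nat) : pword L -> size L + size R \notin map (addn (size R)) L.
Proof. by move=> wL; apply/mapP => -[x /(pword_lt wL)]; lia. Qed.

Lemma top_notin_join_asc L (R : seq nat) : 0 < size R -> pword L ->
  (size L + size R).+1 \notin map (addn (size R).+1) L ++ [:: (size R).-1].
Proof.
move=> R_gt0 wL; rewrite mem_cat inE negb_or; apply/andP; split; last lia.
by apply/mapP => -[x /(pword_lt wL)]; lia.
Qed.

Lemma join_inj n : {in pword_pairs n &, injective (fun p => join p.1 p.2)}.
Proof.
move=> [L R] [L' R']; rewrite !mem_pword_pairs => /and3P[wL wR /eqP sz].
move=> /and3P[wL' wR' /eqP sz'] /=; rewrite /join.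
have := top_notin_join R wL; have := top_notin_join R' wL'; rewrite sz sz' => nL' nL.
by case/(cat_cons_inj nL nL') => + eqR; rewrite eqR => /(inj_map (@addnI _))->.
Qed.

(** The letter before the top is [(size R).-1], which determines [size R] once [R] is known to be
    nonempty. *)
Lemma join_asc_inj n : {in [pred p in pword_pairs n | 0 < size p.2] &,
  injective (fun p => join_asc p.1 p.2)}.
Proof.
move=> [L R] [L' R']; rewrite !inE !mem_pword_pairs /=.
move=> /andP[/and3P[wL wR /eqP sz] R_gt0] /andP[/and3P[wL' wR' /eqP sz'] R_gt0'].
rewrite /join_asc -(cat1s (size R).-1) -(cat1s (size R').-1) !catA.
have := top_notin_join_asc R_gt0 wL; have := top_notin_join_asc R_gt0' wL'.
rewrite sz sz' => nL' nL /(cat_cons_inj nL nL')[]; rewrite !cats1 => /rcons_inj[+ eqm].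
have eqsz : size R = size R' by rewrite -(prednK R_gt0) eqm prednK.
by rewrite eqsz => /(inj_map (@addnI _))-> /(inj_map (can_inj (bumpK _)))->.
Qed.

(** The two joins reach every such word exactly once. As [join_asc] creates a 132, its parts must
    avoid it. It adds two letters, hence [n.-1]; for [n = 0] the second sum is empty because [R] has
    to be nonempty. *)
Lemma sum_n132_le1 n (F : seq nat -> nat) :
  \sum_(s <- permutations (iota 0 n.+1) | n132 s <= 1) F s =
  \sum_(p <- pword_pairs n | n132 p.1 + n132 p.2 <= 1) F (join p.1 p.2) +
  \sum_(p <- pword_pairs n.-1 | (0 < size p.2) && (n132 p.1 + n132 p.2 == 0))
     F (join_asc p.1 p.2).
Proof.
rewrite -big_filter -[X in _ = X + _]big_filter -[X in _ = _ + X]big_filter.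
set P1 := filter _ (pword_pairs n); set P2 := filter _ (pword_pairs n.-1).
rewrite -(big_map (fun p => join p.1 p.2) xpredT F).
rewrite -(big_map (fun p => join_asc p.1 p.2) xpredT F) -big_cat.
apply/perm_big/uniq_perm; first by rewrite filter_uniq ?permutations_uniq.
  rewrite cat_uniq !map_inj_in_uniq ?filter_uniq ?pword_pairs_uniq // ?andbT /=.
  - apply/hasPn => _ /mapP[[L R] + ->]; rewrite mem_filter mem_pword_pairs /=.
    move=> /andP[/andP[R_gt0 _] /and3P[wL wR _]]; apply/mapP => -[[L' R']].
    rewrite mem_filter mem_pword_pairs /= => /andP[_ /and3P[wL' wR' _]] eqj.
    have eqsz : size L' + size R' = (size L + size R).+1.
      by have := congr1 size eqj; rewrite size_join size_join_asc => -[->].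
    move: eqj; rewrite /join /join_asc -(cat1s (size R).-1) catA.
    have := top_notin_join_asc R_gt0 wL; have := top_notin_join R' wL'.
    rewrite eqsz => nL' nL /(cat_cons_inj nL nL')[eqL eqR].
    (* Disjointness of the two images: the letter before the top of [join_asc L R] is below
       [size R], but in [join L' R'] the letters before the top are at least [size R'], which equals
       [size R]. *)
    have := mem_cat (size R).-1 (map (addn (size R).+1) L) [:: (size R).-1].
    rewrite mem_head orbT eqL => /mapP[x _].
    have := congr1 size eqR; rewrite size_map /= => <- /eqP; rewrite eqn_leq; lia.
  - move=> p q; rewrite !mem_filter => /andP[/andP[p_gt0 _] pP] /andP[/andP[q_gt0 _] qP].
    by apply: (@join_asc_inj n.-1); apply/andP.
  - by move=> p q; rewrite !mem_filter => /andP[_ pP] /andP[_ qP]; apply: join_inj pP qP.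
move=> s; rewrite mem_filter mem_pwords mem_cat; apply/idP/idP.
  case/and3P=> s_le1 ws /eqP szs; have [L [R [def_s pLR]]] := pword_split ws szs.
  have uLR : uniq (L ++ R) by rewrite (perm_uniq pLR) iota_uniq.
  have nLR : all (gtn n) (L ++ R) by apply/allP => x; rewrite (perm_mem pLR) mem_iota.
  move: s_le1 szs; rewrite def_s => s_le1 szs; apply/orP.
  have [LR|[L' [l [defL szR LR]]]] := n132_split uLR nLR s_le1.
    left; have [L0 [R0 [wL0 wR0 eqj]]] := join_surj LR pLR.
    apply/mapP; exists (L0, R0) => //; rewrite mem_filter mem_pword_pairs /= wL0 wR0.
    move: s_le1 szs; rewrite eqj n132_join // size_join => -> /eqP; by rewrite eqSS.
  right; rewrite defL in pLR; have [L0 [R0 [wL0 wR0 R_gt0 eqj]]] := join_asc_surj szR LR pLR.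
  apply/mapP; exists (L0, R0); last by rewrite defL.
  move: s_le1 szs; rewrite defL eqj mem_filter mem_pword_pairs /= wL0 wR0 R_gt0.
  rewrite n132_join_asc // size_join_asc => le1 [<-] /=.
  by rewrite eqxx andbT -leqn0.
case/orP => /mapP[[L R]]; rewrite mem_filter mem_pword_pairs /=.
  move=> /andP[le1 /and3P[wL wR /eqP sz]] ->.
  by rewrite n132_join // le1 pword_join // size_join sz eqxx.
move=> /andP[/andP[R_gt0 eq0] /and3P[wL wR /eqP sz]] ->.
by rewrite n132_join_asc // (eqP eq0) pword_join_asc // size_join_asc sz prednK //; lia.
Qed.

(** * Recurrences for the numbers of words *)

(* The prescribed numbers [i], [j] of occurrences of 132 and of [k] are 0 or 1. *)
Definition nwords (i j : bool) (k n : nat) : nat :=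
  \sum_(s <- permutations (iota 0 n)) ((n132 s == i) && (inc k s == j)).

Definition conv (f g : nat -> nat) (n : nat) : nat :=
  \sum_(m < n.+1) f (n - m) * g m.

(** The boolean [i] serves as a factor: [join_asc] creates a 132, so it contributes only when one is
    prescribed, and its parts then contain none. *)
Lemma nwords_split i j k n : nwords i j k n.+1 =
  \sum_(p <- pword_pairs n)
     ((n132 p.1 + n132 p.2 == i) && (inc k (join p.1 p.2) == j)) +
  i * \sum_(p <- pword_pairs n.-1 | 0 < size p.2)
     ((n132 p.1 + n132 p.2 == 0) && (inc k (join_asc p.1 p.2) == j)).
Proof.
rewrite /nwords.
transitivity (\sum_(s <- permutations (iota 0 n.+1) | n132 s <= 1)
                 ((n132 s == i) && (inc k s == j))).
  rewrite [RHS]big_mkcond; apply: eq_bigr => s _.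
  case: leqP => // gt1; rewrite gtn_eqF //; by apply: leq_ltn_trans gt1; case: (i).
rewrite (sum_n132_le1 n (fun s => (n132 s == i) && (inc k s == j))) /=; congr (_ + _).
  rewrite big_mkcond big_seq [RHS]big_seq /=.
  apply: eq_bigr => -[L R]; rewrite mem_pword_pairs => /and3P[wL wR _] /=.
  rewrite n132_join //; case: leqP => // gt1.
  by rewrite gtn_eqF //; apply: leq_ltn_trans gt1; case: (i).
rewrite big_distrr /= big_mkcondr.
rewrite big_seq_cond [RHS]big_seq_cond; apply: eq_bigr => -[L R].
rewrite mem_pword_pairs /= => /andP[/and3P[wL wR _] R_gt0].
rewrite n132_join_asc //; case: eqP => [->|_]; last by rewrite muln0.
by case: i; rewrite ?mul1n.
Qed.

Lemma conv_pairs n (f g : seq nat -> bool) :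
  \sum_(p <- pword_pairs n) (f p.1 && g p.2 : nat) =
  conv (fun n => \sum_(s <- permutations (iota 0 n)) (f s : nat))
       (fun n => \sum_(s <- permutations (iota 0 n)) (g s : nat)) n.
Proof.
rewrite /conv -(sum_pword_pairs n (fun s => f s : nat) (fun s => g s : nat)).
by apply: eq_bigr => p _; rewrite mulnb.
Qed.

Lemma conv_pairs_pos n (f g : seq nat -> bool) :
  \sum_(p <- pword_pairs n | 0 < size p.2) (f p.1 && g p.2 : nat) =
  conv (fun n => \sum_(s <- permutations (iota 0 n)) (f s : nat))
       (fun n => (0 < n) * \sum_(s <- permutations (iota 0 n)) (g s : nat)) n.
Proof.
rewrite big_mkcond (eq_bigr (fun p => f p.1 * ((0 < size p.2) && g p.2))); last first.
  by move=> p _; rewrite -mulnb; case: (0 < size p.2); rewrite ?mul1n ?mul0n ?muln0 ?mulnb.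
rewrite (sum_pword_pairs n (fun s => f s : nat) (fun s => (0 < size s) && g s : nat)).
apply: eq_bigr => m _; congr (_ * _); rewrite big_distrr /= big_seq [RHS]big_seq.
apply: eq_bigr => s; rewrite mem_pwords => /andP[_ /eqP<-].
by rewrite mulnb.
Qed.

(** A join adds [inc k.+2 L] and [inc k.+1 L]. When the total is at most one, this dichotomy makes
    the first term vanish, and the left part is counted at [k.+1] alone. *)
Lemma inc_gt1_imp k s : inc k.+2 s = 0 \/ 1 < inc k.+1 s.
Proof. by case: (posnP (inc k.+2 s)) => [|/inc_gt1]; [left | right]. Qed.

Lemma nwords00S k n :
  nwords false false k.+2 n.+1 =
  conv (nwords false false k.+1) (nwords false false k.+2) n.
Proof.
rewrite nwords_split mul0n addn0 -conv_pairs big_seq [RHS]big_seq.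
apply: eq_bigr => -[L R]; rewrite mem_pword_pairs => /and3P[wL wR _] /=.
rewrite inc_join //; have := inc_gt1_imp k L; lia.
Qed.

Lemma nwords01S k n :
  nwords false true k.+2 n.+1 =
  conv (nwords false false k.+1) (nwords false true k.+2) n +
  conv (nwords false true k.+1) (nwords false false k.+2) n.
Proof.
rewrite nwords_split mul0n addn0 -!conv_pairs -big_split big_seq [RHS]big_seq.
apply: eq_bigr => -[L R]; rewrite mem_pword_pairs => /and3P[wL wR _] /=.
rewrite inc_join //; have := inc_gt1_imp k L; lia.
Qed.

(** Discards the empty word, as the right part of [join_asc] is nonempty. *)
Definition posn (f : nat -> nat) (n : nat) : nat := (0 < n) * f n.

Lemma nwords10S k n :
  nwords true false k.+3 n.+1 =
  conv (nwords true false k.+2) (nwords false false k.+3) n +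
  conv (nwords false false k.+2) (nwords true false k.+3) n +
  conv (nwords false false k.+2) (posn (nwords false false k.+3)) n.-1.
Proof.
rewrite nwords_split mul1n -!conv_pairs -conv_pairs_pos -big_split.
congr (_ + _); rewrite big_seq_cond [RHS]big_seq_cond; apply: eq_bigr => -[L R].
  rewrite mem_pword_pairs => /andP[/and3P[wL wR _] _] /=.
  rewrite inc_join //; have := inc_gt1_imp k.+1 L; lia.
rewrite mem_pword_pairs => /andP[/and3P[wL wR _] R_gt0] /=.
rewrite inc_join_asc //; have := inc_gt1_imp k.+1 L; lia.
Qed.

(** The 132 and the increasing pattern each come from the left or the right part, whence four
    products; in the last two terms the join itself supplies the 132. *)
Lemma nwords11S k n :
  nwords true true k.+3 n.+1 =
  conv (nwords true true k.+2) (nwords false false k.+3) n +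
  conv (nwords true false k.+2) (nwords false true k.+3) n +
  conv (nwords false true k.+2) (nwords true false k.+3) n +
  conv (nwords false false k.+2) (nwords true true k.+3) n +
  (conv (nwords false true k.+2) (posn (nwords false false k.+3)) n.-1 +
   conv (nwords false false k.+2) (posn (nwords false true k.+3)) n.-1).
Proof.
rewrite nwords_split mul1n -!conv_pairs -!conv_pairs_pos -!big_split.
congr (_ + _); rewrite big_seq_cond [RHS]big_seq_cond; apply: eq_bigr => -[L R].
  rewrite mem_pword_pairs => /andP[/and3P[wL wR _] _] /=.
  rewrite inc_join //; have := inc_gt1_imp k.+1 L; lia.
rewrite mem_pword_pairs => /andP[/and3P[wL wR _] R_gt0] /=.
rewrite inc_join_asc //; have := inc_gt1_imp k.+1 L; lia.
Qed.

Lemma nwords_n0 i j k : nwords i j k.+1 0 = ~~ i && ~~ j.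
Proof. by rewrite /nwords /= big_seq1; case: i; case: j. Qed.

Lemma nwords1_small j k n : k < 2 -> nwords true j k.+1 n = 0.
Proof.
move=> k2; rewrite /nwords big1 // => s _; apply/eqP; rewrite eqb0.
apply/negP => /andP[/eqP s1 /eqP incs].
have : 1 < inc k.+1 s by apply: inc12_gt1; rewrite ?s1 //; lia.
by rewrite incs; case: j {incs}.
Qed.

Lemma nwords00_1 n : nwords false false 1 n = (n == 0).
Proof.
case: n => [|n]; first by rewrite nwords_n0.
rewrite /nwords big_seq big1 // => s; rewrite mem_pwords inc1 => /andP[_ /eqP->].
by rewrite andbF.
Qed.

Lemma nwords01_1 n : nwords false true 1 n = (n == 1).
Proof.
case: n => [|[|n]]; first by rewrite nwords_n0.
  by rewrite /nwords big_seq1.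
rewrite /nwords big_seq big1 // => s; rewrite mem_pwords inc1 => /andP[_ /eqP->].
by rewrite andbF.
Qed.

(** * Translation from permutations to words *)

Definition perm_word (n : nat) (p : 'S_n) : seq nat := [seq val (p i) | i <- enum 'I_n].

Lemma size_perm_word n (p : 'S_n) : size (perm_word p) = n.
Proof. by rewrite size_map size_enum_ord. Qed.

Lemma nth_perm_word n (p : 'S_n) (i : 'I_n) : nth 0 (perm_word p) i = p i.
Proof. by rewrite (nth_map i) ?size_enum_ord // nth_ord_enum. Qed.

Lemma perm_word_uniq n (p : 'S_n) : uniq (perm_word p).
Proof. by rewrite map_inj_uniq ?enum_uniq // => i j /val_inj/perm_inj. Qed.

Lemma perm_word_inj n : injective (@perm_word n).
Proof.
by move=> p q eq_pq; apply/permP => i; apply/val_inj; rewrite /= -!nth_perm_word eq_pq.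
Qed.

(** Both lists are free of repetitions and have [n!] entries, so an inclusion suffices. *)
Lemma perm_eq_perm_word n :
  perm_eq [seq perm_word p | p : 'S_n] (permutations (iota 0 n)).
Proof.
have uw : uniq [seq perm_word p | p : 'S_n].
  by rewrite map_inj_uniq ?enum_uniq //; apply: perm_word_inj.
have [||szw eqw] := uniq_min_size uw (s2 := permutations (iota 0 n)).
- move=> _ /mapP[p _ ->]; rewrite mem_permutations.
  have [||sz eqp] := @uniq_min_size _ (perm_word p) (iota 0 n) (perm_word_uniq p).
  + by move=> _ /mapP[i _ ->]; rewrite mem_iota /=.
  + by rewrite size_iota size_perm_word.
  by apply: uniq_perm; rewrite ?iota_uniq ?perm_word_uniq.
- by rewrite size_permutations ?iota_uniq // size_iota size_map -cardE card_Sn.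
by apply: uniq_perm; rewrite ?permutations_uniq.
Qed.

Definition ord_iso (k : nat) (tau : 'S_k) (t : seq nat) : bool :=
  (size t == k) &&
  [forall a : 'I_k, forall b : 'I_k, (nth 0 t a < nth 0 t b) == (tau a < tau b)].

Lemma sorted_ltn_subseq_iota n s :
  sorted ltn s -> all (gtn n) s -> subseq s (iota 0 n).
Proof.
move=> s_sorted /allP sn; rewrite (_ : s = filter [in s] (iota 0 n)) ?filter_subseq //.
apply: (irr_sorted_eq ltn_trans ltnn) => //.
  by apply: sorted_filter; [apply: ltn_trans | apply: iota_ltn_sorted].
by move=> x; rewrite mem_filter mem_iota /=; apply/esym/andb_idr => /sn.
Qed.

Lemma sorted_enum_ord n : sorted (fun i j : 'I_n => i < j) (enum 'I_n).
Proof. by have := iota_ltn_sorted 0 n; rewrite -val_enum_ord sorted_map. Qed.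

(** Sending [f] to the word of the values [p (f a)] is injective because [p] is, and it reaches
    every subsequence with the right relative order. *)
Lemma card_occurrences k n (tau : 'S_k) (p : 'S_n) :
  #|occurrences tau p| = count (ord_iso tau) (subseqs (perm_word p)).
Proof.
pose w (f : {ffun 'I_k -> 'I_n}) := [seq val (p (f a)) | a <- enum 'I_k].
have nth_w f (a : 'I_k) : nth 0 (w f) a = p (f a).
  by rewrite (nth_map a) ?size_enum_ord // nth_ord_enum.
have size_w f : size (w f) = k by rewrite size_map size_enum_ord.
have w_inj : injective w.
  move=> f g eq_fg; apply/ffunP => a; apply: (@perm_inj _ p); apply/val_inj.
  by rewrite /= -!nth_w eq_fg.
rewrite cardE -(size_map w) -size_filter; apply/perm_size/uniq_perm.
- by rewrite map_inj_uniq ?enum_uniq.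
- by rewrite filter_uniq ?subseqs_uniq ?perm_word_uniq.
move=> t; rewrite mem_filter mem_subseqs; apply/mapP/andP.
  case=> f; rewrite mem_enum inE => /andP[/forallP f_incr /forallP f_iso] ->; split.
    rewrite /ord_iso size_w eqxx /=; apply/forallP => a; apply/forallP => b.
    by rewrite !nth_w; have /forallP := f_iso a; apply.
  (* The positions [f a] increase, hence form a subsequence of [iota 0 n]; reading off letters
     preserves subsequences. *)
  have -> : w f = map (nth 0 (perm_word p)) [seq val (f a) | a <- enum 'I_k].
    by rewrite -map_comp; apply: eq_map => a /=; rewrite nth_perm_word.
  rewrite -[X in subseq _ X](mkseq_nth 0) size_perm_word; apply: map_subseq.
  apply: sorted_ltn_subseq_iota; last by apply/allP => _ /mapP[a _ ->] /=.
  rewrite sorted_map; apply: sub_sorted (sorted_enum_ord k) => a b ab /=.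
  by have /forallP/(_ b)/implyP := f_incr a; apply.
case=> /andP[/eqP szt /forallP t_iso] sub_t.
have /fin_all_exists[f fP] (a : 'I_k) : exists i : 'I_n, p i = nth 0 t a :> nat.
  have : nth 0 t a \in perm_word p by rewrite (mem_subseq sub_t) // mem_nth ?szt.
  by case/mapP=> i _ ->; exists i.
exists [ffun a => f a]; last first.
  apply: (@eq_from_nth _ 0); rewrite ?size_w // => i; rewrite szt => i_k.
  by rewrite (nth_w _ (Ordinal i_k)) ffunE /= -[i]/(val (Ordinal i_k)) -fP.
rewrite mem_enum inE; apply/andP; split; apply/forallP => a; apply/forallP => b.
  apply/implyP => ab; rewrite !ffunE.
  have index_f (c : 'I_k) : index (nth 0 t c) (perm_word p) = f c.
    by rewrite -fP -nth_perm_word index_uniq ?perm_word_uniq // size_perm_word.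
  (* [perm_word p] is sorted when letters are compared by position, and its subsequence [t] inherits
     this. *)
  pose r := relpre (index^~ (perm_word p)) ltn.
  have r_tr : transitive r by move=> x y z; apply: ltn_trans.
  suff : r (nth 0 t a) (nth 0 t b) by rewrite /r /= !index_f.
  apply: (sorted_ltn_nth r_tr); rewrite ?inE ?szt //.
  apply: subseq_sorted sub_t _ => //; rewrite sorted_map.
  apply: sub_sorted (sorted_enum_ord n) => i j ij /=.
  by rewrite -!nth_perm_word !index_uniq ?perm_word_uniq ?size_perm_word.
by rewrite !ffunE !fP; have /forallP := t_iso a; apply.
Qed.

Lemma ord_iso_id k t : ord_iso (idpat k) t = (size t == k) && sorted ltn t.
Proof.
rewrite /ord_iso; case: eqP => //= szt; apply/forallP/idP => [t_iso|t_sorted a].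
  apply/(sortedP 0) => i; rewrite szt => i_k.
  have /forallP/(_ (Ordinal i_k))/eqP := t_iso (Ordinal (ltnW i_k)).
  by rewrite !perm1 /= ltnSn.
apply/forallP => b; rewrite !perm1; apply/eqP.
have tM := sorted_ltn_nth ltn_trans 0 t_sorted.
case: (ltngtP a b) => [ab|ba|/val_inj->]; last by rewrite ltnn.
  by apply: tM; rewrite ?inE ?szt.
by apply/negbTE; rewrite -leqNgt ltnW //; apply: tM; rewrite ?inE ?szt.
Qed.

Lemma pat132E : (pat132 ord0 = 0 :> nat) * (pat132 (inord 1) = 2 :> nat)
                * (pat132 (inord 2) = 1 :> nat).
Proof.
by rewrite /pat132 tpermL tpermR tpermD ?inordK // -val_eqE /= inordK.
Qed.

Lemma ord_iso132 t :
  ord_iso pat132 t = if t is [:: x; y; z] then x < z < y else false.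
Proof.
rewrite /ord_iso; case: t => [|x [|y [|z [|]]]] //=.
apply/forallP/andP => [t_iso|[xz zy] a].
  have /forallP/(_ (inord 2)) := t_iso ord0; have /forallP/(_ (inord 1)) := t_iso (inord 2).
  by rewrite !pat132E !inordK //= => /eqP-> /eqP->.
apply/forallP => b; have ordE (c : 'I_3) : [\/ c = ord0, c = inord 1 | c = inord 2].
  case: c => -[|[|[|]]] // c3; [apply: Or31 | apply: Or32 | apply: Or33];
  by apply/val_inj; rewrite /= ?inordK.
by case: (ordE a) => ->; case: (ordE b) => ->; rewrite !pat132E ?inordK //=; lia.
Qed.

Lemma phi_nwords k n : phi (idpat k) n = nwords true true k n.
Proof.
rewrite /nwords -(perm_big _ (perm_eq_perm_word n)) big_image /= /phi.
rewrite -sum1dep_card big_mkcond; apply: eq_bigr => p _.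
rewrite /contains_once !card_occurrences (eq_count ord_iso132) (eq_count (@ord_iso_id k)).
by case: (_ && _).
Qed.

Local Open Scope ring_scope.

(** * Solution of the recurrences by Chebyshev polynomials *)

Section Algebra.

(** [A], [B], [C], [D] stand for the series in the order absent-absent, absent-once, once-absent,
    once-once, with 132 named first. As [R] has no division, every solution is stated with its
    denominator multiplied out. *)
Variables (R : comNzRingType) (x : R) (V A B C D T Z S : nat -> R).
Hypotheses (V0 : V 0%N = 1) (V1 : V 1%N = 1)
  (VS : forall k, V k.+2 = V k.+1 - x * V k).
Hypotheses (A1 : A 1%N = 1) (AS : forall k, A k.+2 = 1 + x * (A k.+1 * A k.+2)).
Hypotheses (B1 : B 1%N = x)
  (BS : forall k, B k.+2 = x * (A k.+1 * B k.+2 + B k.+1 * A k.+2)).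
Hypotheses (C2 : C 2%N = 0)
  (CS : forall k, C k.+3 = x * (C k.+2 * A k.+3 + A k.+2 * C k.+3)
                           + x ^+ 2 * (A k.+2 * (A k.+3 - 1))).
Hypotheses (D2 : D 2%N = 0)
  (DS : forall k, D k.+3 = x * (D k.+2 * A k.+3 + C k.+2 * B k.+3
                                + B k.+2 * C k.+3 + A k.+2 * D k.+3)
                           + x ^+ 2 * (B k.+2 * (A k.+3 - 1) + A k.+2 * B k.+3)).
Hypotheses (T0 : T 0%N = - 1) (TS : forall k, T k.+1 = x * T k + V k.+1 ^+ 2).
Hypothesis (ZS : forall k, Z k.+1 = Z k * (V k.+2 * V k.+3)).
Hypotheses (S0 : S 0%N = 0)
  (SS : forall k, S k.+1 = S k * (V k.+2 * V k.+3) + T k.+2 * Z k).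

(** The defect [V k * V k.+2 - V k.+1 ^+ 2] is multiplied by [x] at each step. *)
Lemma cassini k : V k * V k.+2 = V k.+1 ^+ 2 - x ^+ k.+1.
Proof.
elim: k => [|k IHk]; first by rewrite VS V0 V1; ring.
have -> : V k.+1 * V k.+3 = V k.+2 ^+ 2 + x * (V k * V k.+2) - x * V k.+1 ^+ 2.
  by rewrite (VS k.+1) (VS k); ring.
by rewrite IHk [x ^+ k.+2]exprS; ring.
Qed.

(** With division, [A k.+2 = 1 / (1 - x * A k.+1)] is a continued fraction with convergents
    [V k / V k.+1]. *)
Lemma gf_avoid_avoid k : V k.+1 * A k.+1 = V k.
Proof.
elim: k => [|k IHk]; first by rewrite V0 V1 A1 mulr1.
(* Regrouped so that the recurrence and the induction hypothesis apply to whole factors; the other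
   recurrences are treated alike. *)
have -> : V k.+2 * A k.+2 = V k.+1 * (A k.+2 - x * (A k.+1 * A k.+2))
                            + x * A k.+2 * (V k.+1 * A k.+1 - V k).
  by rewrite VS; ring.
by rewrite {1}AS addrK IHk subrr mulr0 addr0 mulr1.
Qed.

Lemma gf_avoid_once k : V k.+1 ^+ 2 * B k.+1 = x ^+ k.+1.
Proof.
elim: k => [|k IHk]; first by rewrite V1 B1 expr1n mul1r.
have -> : V k.+2 ^+ 2 * B k.+2 =
    V k.+2 * V k.+1 * (B k.+2 - x * (A k.+1 * B k.+2 + B k.+1 * A k.+2))
    + V k.+2 * x * B k.+2 * (V k.+1 * A k.+1 - V k)
    + x * V k.+1 * B k.+1 * (V k.+2 * A k.+2).
  by rewrite (VS k); ring.
rewrite -BS !gf_avoid_avoid !subrr !mulr0 !add0r [RHS]exprS -IHk; ring.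
Qed.

Lemma gf_once_avoid_rec k :
  V k.+3 ^+ 2 * C k.+3 = x * (V k.+2 ^+ 2 * C k.+2) + x ^+ 3 * V k.+1 ^+ 2.
Proof.
have -> : V k.+3 ^+ 2 * C k.+3 =
    V k.+3 * V k.+2 * (C k.+3 - (x * (C k.+2 * A k.+3 + A k.+2 * C k.+3)
                                 + x ^+ 2 * (A k.+2 * (A k.+3 - 1))))
    + V k.+3 * x * C k.+3 * (V k.+2 * A k.+2 - V k.+1)
    + x * V k.+2 * C k.+2 * (V k.+3 * A k.+3)
    + x ^+ 2 * (V k.+2 * A k.+2) * (V k.+3 * A k.+3 - V k.+3).
  by rewrite (VS k.+1); ring.
by rewrite -CS !gf_avoid_avoid (VS k.+1) !subrr !mulr0; ring.
Qed.

(** Unfolded, [T k] is the sum of [x ^+ (k - j) * V j ^+ 2] over [1 <= j <= k], minus [x ^+ k]; the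
    term [x ^+ k.+3] cancels this offset. *)
Lemma gf_once_avoid k : V k.+2 ^+ 2 * C k.+2 = x ^+ 3 * T k + x ^+ k.+3.
Proof.
elim: k => [|k IHk]; first by rewrite C2 T0; ring.
by rewrite gf_once_avoid_rec IHk TS [x ^+ k.+4]exprS; ring.
Qed.

(** Once denominators are cleared, the two products of [B] and [C] and the two terms with [x ^+ 2]
    collapse, by the Cassini identity, into one multiple of [T k.+2]. *)
Lemma gf_once_once_rec k :
  V k.+2 * V k.+3 * (V k.+3 ^+ 2 * D k.+3) =
  x * (V k.+2 * V k.+3) * (V k.+2 ^+ 2 * D k.+2) + 2%:R * x ^+ k.+4.+1 * T k.+2.
Proof.
have -> : V k.+2 * V k.+3 * (V k.+3 ^+ 2 * D k.+3) =
    (V k.+2 * V k.+3) ^+ 2 *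
      (D k.+3 - (x * (D k.+2 * A k.+3 + C k.+2 * B k.+3
                      + B k.+2 * C k.+3 + A k.+2 * D k.+3)
                 + x ^+ 2 * (B k.+2 * (A k.+3 - 1) + A k.+2 * B k.+3)))
    + x * V k.+2 * V k.+3 ^+ 2 * D k.+3 * (V k.+2 * A k.+2 - V k.+1)
    + x * V k.+2 ^+ 2 * V k.+3 * D k.+2 * (V k.+3 * A k.+3)
    + x * ((V k.+2 ^+ 2 * C k.+2) * (V k.+3 ^+ 2 * B k.+3)
           + (V k.+2 ^+ 2 * B k.+2) * (V k.+3 ^+ 2 * C k.+3))
    + x ^+ 2 * ((V k.+2 ^+ 2 * B k.+2) * V k.+3 * (V k.+3 * A k.+3 - V k.+3)
                + (V k.+2 * A k.+2) * V k.+2 * (V k.+3 ^+ 2 * B k.+3)).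
  by rewrite (VS k.+1); ring.
rewrite -DS !gf_avoid_avoid !gf_avoid_once !gf_once_avoid !TS.
have := cassini k.+1; rewrite (VS k.+1) !subrr !mulr0 => cas.
have -> : V k.+2 ^+ 2 = V k.+1 * (V k.+2 - x * V k.+1) + x ^+ k.+2 by rewrite cas; ring.
by rewrite !exprS; ring.
Qed.

(** Each step adds a fraction [T i.+2 / (V i.+2 * V i.+3)]; [S] and [Z] carry the sum over a common
    denominator. *)
Lemma gf_once_once k : V k.+2 ^+ 2 * Z k * D k.+2 = 2%:R * x ^+ k.+4 * S k.
Proof.
elim: k => [|k IHk]; first by rewrite D2 S0 !mulr0.
rewrite ZS SS.
have -> : V k.+3 ^+ 2 * (Z k * (V k.+2 * V k.+3)) * D k.+3 =
          Z k * (V k.+2 * V k.+3 * (V k.+3 ^+ 2 * D k.+3)) by ring.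
rewrite gf_once_once_rec mulrDr.
have -> : Z k * (x * (V k.+2 * V k.+3) * (V k.+2 ^+ 2 * D k.+2)) =
          x * (V k.+2 * V k.+3) * (V k.+2 ^+ 2 * Z k * D k.+2) by ring.
by rewrite IHk [x ^+ k.+4.+1]exprS; ring.
Qed.

End Algebra.

(** * Generating functions as truncated series *)

(* Power series are handled modulo [x^(N+1)], in a quotient ring of [Q[x]]. *)
Section TruncatedSeries.

Variable N : nat.

Let pi : {poly rat} -> {poly %/ 'X^(N.+1) : {poly rat}} := in_qpoly 'X^(N.+1).

Lemma in_qpolyXnE (p : {poly rat}) : pi p = take_poly N.+1 p :> {poly rat}.
Proof.
(* [mk_monic] replaces moduli that are constant or not monic; the exponent [N.+1] is positive, so
   this one is kept. *)
have mkX : mk_monic ('X^(N.+1) : {poly rat}) = 'X^(N.+1).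
  by rewrite /mk_monic size_polyXn monicXn.
have piX : pi 'X^(N.+1) = 0.
  by apply/val_inj; rewrite /= mkX; apply: Pdiv.RingMonic.rmodpp; apply: monicXn.
have -> : pi p = pi (take_poly N.+1 p).
  rewrite -{1}(poly_take_drop N.+1 p) /pi in_qpolyD in_qpolyM.
  by move: piX; rewrite /pi => ->; rewrite mulr0 addr0.
rewrite in_qpoly_small // mkX size_polyXn ltnS.
exact: size_take_poly.
Qed.

Lemma in_qpolyXn_eqP (p q : {poly rat}) :
  pi p = pi q <-> forall i, (i <= N)%N -> p`_i = q`_i.
Proof.
split=> [eq_pq i iN|eq_pq].
  have := congr1 (fun r : {poly %/ _} => (r : {poly rat})`_i) eq_pq.
  by rewrite !in_qpolyXnE !coef_take_poly ltnS iN.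
apply/val_inj; rewrite /= -[LHS]/(pi p : {poly rat}) -[RHS]/(pi q : {poly rat}).
rewrite !in_qpolyXnE; apply/polyP => i; rewrite !coef_take_poly ltnS.
by case: leqP => // /eq_pq.
Qed.

Definition ser_poly (f : nat -> nat) : {poly rat} := \poly_(i < N.+1) (f i)%:R.

Definition ser (f : nat -> nat) := pi (ser_poly f).

Lemma coef_ser_poly f i : (i <= N)%N -> (ser_poly f)`_i = (f i)%:R.
Proof. by rewrite coef_poly ltnS => ->. Qed.

Lemma eq_ser f g : f =1 g -> ser f = ser g.
Proof. by move=> fg; apply/in_qpolyXn_eqP => i iN; rewrite !coef_ser_poly ?fg. Qed.

Lemma ser_add f g : ser (fun n => f n + g n)%N = ser f + ser g.
Proof.
rewrite /ser -rmorphD; apply/in_qpolyXn_eqP => i iN.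
by rewrite coefD !coef_ser_poly // natrD.
Qed.

Lemma ser_conv f g : ser (conv f g) = ser f * ser g.
Proof.
rewrite /ser -rmorphM; apply/in_qpolyXn_eqP => i iN.
rewrite coef_ser_poly // mulrC coefM natr_sum; apply: eq_bigr => j _.
have jN : (j <= N)%N by apply: leq_trans iN; rewrite -ltnS.
by rewrite !coef_ser_poly // ?natrM 1?mulrC // (leq_trans (leq_subr _ _)).
Qed.

Lemma ser_shift f g :
  f 0%N = 0%N -> (forall n, f n.+1 = g n) -> ser f = pi 'X * ser g.
Proof.
move=> f0 fS; rewrite /ser -rmorphM; apply/in_qpolyXn_eqP => i iN.
rewrite coef_ser_poly // coefXM; case: i iN => [|i] iN; first by rewrite f0.
by rewrite /= fS coef_ser_poly // ltnW.
Qed.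

Lemma ser1 : ser (fun n => n == 0%N) = 1.
Proof.
rewrite -(rmorph1 (in_qpoly 'X^(N.+1))); apply/in_qpolyXn_eqP => i iN.
by rewrite coef_ser_poly // coef1.
Qed.

Lemma serX : ser (fun n => n == 1%N) = pi 'X.
Proof. by apply/in_qpolyXn_eqP => i iN; rewrite coef_ser_poly // coefX. Qed.

Lemma ser0 f : (forall n, f n = 0%N) -> ser f = 0.
Proof.
move=> f0; rewrite -(rmorph0 (in_qpoly 'X^(N.+1))); apply/in_qpolyXn_eqP => i iN.
by rewrite coef_ser_poly // f0 coef0.
Qed.

Lemma ser_avoid_posn k :
  ser (posn (nwords false false k.+1)) = ser (nwords false false k.+1) - 1.
Proof.
apply/(canRL (addrK _)); rewrite -ser1 -ser_add; apply: eq_ser => -[|n].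
  by rewrite nwords_n0.
by rewrite /posn mul1n addn0.
Qed.

Lemma ser_once_posn k :
  ser (posn (nwords false true k.+1)) = ser (nwords false true k.+1).
Proof. by apply: eq_ser => -[|n]; rewrite /posn ?nwords_n0 ?mul1n. Qed.

(** At [n = 0] the predecessor is a default value, but [posn g] vanishes at 0, so [n.-1] acts as a
    true shift. *)
Lemma ser_conv_posn f g :
  ser (fun n => conv f (posn g) n.-1) = pi 'X * (ser f * ser (posn g)).
Proof.
rewrite -ser_conv; apply: ser_shift => //=.
by rewrite /conv big_ord1 /posn mul0n muln0.
Qed.

Lemma ser_avoid_avoid k :
  ser (nwords false false k.+2) =
  1 + pi 'X * (ser (nwords false false k.+1) * ser (nwords false false k.+2)).
Proof.
rewrite -ser_conv.
(* The shift needs value 0 at 0, so the empty word is taken out; it accounts for the summand 1. *)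
rewrite -(ser_shift (f := fun n => if n is m.+1 then nwords false false k.+2 n else 0%N)) //.
  by rewrite -ser1 -ser_add; apply: eq_ser => -[|n]; rewrite ?nwords_n0.
by move=> n; rewrite nwords00S.
Qed.

Lemma ser_avoid_once k :
  ser (nwords false true k.+2) =
  pi 'X * (ser (nwords false false k.+1) * ser (nwords false true k.+2)
           + ser (nwords false true k.+1) * ser (nwords false false k.+2)).
Proof.
by rewrite -!ser_conv -ser_add; apply: ser_shift => [|n]; rewrite ?nwords_n0 ?nwords01S.
Qed.

Lemma ser_once_avoid k :
  ser (nwords true false k.+3) =
  pi 'X * (ser (nwords true false k.+2) * ser (nwords false false k.+3)
           + ser (nwords false false k.+2) * ser (nwords true false k.+3))
  + pi 'X ^+ 2 * (ser (nwords false false k.+2) * (ser (nwords false false k.+3) - 1)).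
Proof.
rewrite -ser_avoid_posn expr2 -mulrA -ser_conv_posn -!ser_conv -mulrDr -!ser_add.
by apply: ser_shift => [|n]; rewrite ?nwords_n0 ?nwords10S.
Qed.

Lemma ser_once_once k :
  ser (nwords true true k.+3) =
  pi 'X * (ser (nwords true true k.+2) * ser (nwords false false k.+3)
           + ser (nwords true false k.+2) * ser (nwords false true k.+3)
           + ser (nwords false true k.+2) * ser (nwords true false k.+3)
           + ser (nwords false false k.+2) * ser (nwords true true k.+3))
  + pi 'X ^+ 2 * (ser (nwords false true k.+2) * (ser (nwords false false k.+3) - 1)
                  + ser (nwords false false k.+2) * ser (nwords false true k.+3)).
Proof.
rewrite -ser_avoid_posn -[X in _ + _ * (_ + _ * X)]ser_once_posn.
rewrite [X in _ + X]mulrDr expr2 -!mulrA -!ser_conv_posn -!ser_conv -!mulrDr -!ser_add.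
by apply: ser_shift => [|n]; rewrite ?nwords_n0 ?nwords11S.
Qed.

Fixpoint chebV (r : nat) : {poly rat} :=
  if r is r1.+1 then
    if r1 is r2.+1 then chebV r1 - 'X * chebV r2 else 1
  else 1.

(* With [U_j] taken at [t = 1/(2 sqrt x)], [sqsum m] is [x^m (U_1^2 + ... + U_m^2 - 1)],
   and [sqrt x * num k / den k] is the outer sum for the pattern [k + 2]. *)
Fixpoint sqsum (m : nat) : {poly rat} :=
  if m is m1.+1 then 'X * sqsum m1 + chebV m ^+ 2 else - 1.

Fixpoint den (k : nat) : {poly rat} :=
  if k is k1.+1 then den k1 * (chebV k1.+2 * chebV k1.+3) else 1.

Fixpoint num (k : nat) : {poly rat} :=
  if k is k1.+1 then num k1 * (chebV k1.+2 * chebV k1.+3) + sqsum k1.+2 * den k1 else 0.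

Lemma ser_phi k :
  pi (chebV k.+2 ^+ 2 * den k) * ser (nwords true true k.+2) =
  pi (2%:R * 'X^(k.+4) * num k).
Proof.
have := @gf_once_once _ (pi 'X) (pi \o chebV) (fun k => ser (nwords false false k))
  (fun k => ser (nwords false true k)) (fun k => ser (nwords true false k))
  (fun k => ser (nwords true true k)) (pi \o sqsum) (pi \o den) (pi \o num).
have -> : pi (chebV k.+2 ^+ 2 * den k) = pi (chebV k.+2) ^+ 2 * pi (den k).
  by rewrite /pi rmorphM rmorphXn.
have -> : pi (2%:R * 'X^(k.+4) * num k) = 2%:R * pi 'X ^+ k.+4 * pi (num k).
  by rewrite /pi 2!rmorphM rmorphXn rmorph_nat.
apply.
- exact: rmorph1.
- exact: rmorph1.
- by move=> j; rewrite /comp /pi -rmorphM -rmorphB.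
- by rewrite -ser1; apply: eq_ser => n; rewrite nwords00_1.
- exact: ser_avoid_avoid.
- by rewrite -[RHS]serX; apply: eq_ser => n; rewrite nwords01_1.
- exact: ser_avoid_once.
- by apply: ser0 => n; rewrite nwords1_small.
- exact: ser_once_avoid.
- by apply: ser0 => n; rewrite nwords1_small.
- exact: ser_once_once.
- by rewrite /comp /pi rmorphN rmorph1.
- by move=> j; rewrite /comp /pi -rmorphXn -rmorphM -rmorphD.
- by move=> j; rewrite /comp /pi -[den j.+1]/(_ * (_ * _)) 2!rmorphM.
- exact: rmorph0.
- by move=> j; rewrite /comp /pi -[num j.+1]/(_ * (_ * _) + _ * _) rmorphD 3!rmorphM.
Qed.

End TruncatedSeries.

(** * Rational functions of [x] among those of its square root *)

Lemma coef0_chebV r : (chebV r)`_0 = 1.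
Proof.
elim/ltn_ind: r => -[|[|r]] IHr; rewrite ?coef1 //.
have -> : chebV r.+2 = chebV r.+1 - 'X * chebV r by [].
by rewrite coefB coefXM IHr // subr0.
Qed.

Lemma coef0_den k : (den k)`_0 = 1.
Proof. by elim: k => [|k IHk]; rewrite ?coef1 // !coef0M IHk !coef0_chebV !mulr1. Qed.

Lemma poly_in_xD p q : poly_in_x (p + q) = poly_in_x p + poly_in_x q.
Proof. by rewrite /poly_in_x !rmorphD. Qed.

Lemma poly_in_xB p q : poly_in_x (p - q) = poly_in_x p - poly_in_x q.
Proof. by rewrite /poly_in_x !rmorphB. Qed.

Lemma poly_in_xM p q : poly_in_x (p * q) = poly_in_x p * poly_in_x q.
Proof. by rewrite /poly_in_x !rmorphM. Qed.

Lemma poly_in_x1 : poly_in_x 1 = 1.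
Proof. by rewrite /poly_in_x !rmorph1. Qed.

Lemma poly_in_x0 : poly_in_x 0 = 0.
Proof. by rewrite /poly_in_x !rmorph0. Qed.

Lemma poly_in_xX : poly_in_x 'X = sqrtx ^+ 2.
Proof. by rewrite /poly_in_x comp_polyX rmorphXn. Qed.

Lemma poly_in_x_neq0 (p : {poly rat}) : p`_0 != 0 -> poly_in_x p != 0.
Proof.
move=> p0; rewrite tofrac_eq0; apply: contra p0 => /eqP/(congr1 (fun q => q.[0])).
by rewrite /= horner_comp hornerXn expr0n horner_coef0 horner_coef0 coef0 => ->.
Qed.

Lemma sqrtx_neq0 : sqrtx != 0.
Proof. by rewrite tofrac_eq0 polyX_eq0. Qed.


(** * Evaluation of the Chebyshev expression at [t] *)

Section Evaluation.

Variables (F : fieldType) (s : F) (V T Z S : nat -> F).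
Hypotheses (two_neq0 : 2%:R != 0 :> F) (s_neq0 : s != 0) (V_neq0 : forall r, V r != 0).
Hypotheses (V0 : V 0%N = 1) (V1 : V 1%N = 1)
  (VS : forall k, V k.+2 = V k.+1 - s ^+ 2 * V k).
Hypotheses (T0 : T 0%N = - 1) (TS : forall k, T k.+1 = s ^+ 2 * T k + V k.+1 ^+ 2).
Hypotheses (Z0 : Z 0%N = 1) (ZS : forall k, Z k.+1 = Z k * (V k.+2 * V k.+3)).
Hypotheses (S0 : S 0%N = 0)
  (SS : forall k, S k.+1 = S k * (V k.+2 * V k.+3) + T k.+2 * Z k).

Let t := (2%:R * s)^-1.

Lemma chebU_eval r : (chebU r).[t] = V r / s ^+ r.
Proof.
elim/ltn_ind: r => -[|[|r]] IHr.
- by rewrite /= hornerC V0 divr1.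
- by rewrite /= hornerZ hornerX V1 /t expr1; field; rewrite two_neq0 s_neq0.
have -> : chebU r.+2 = 2%:R *: 'X * chebU r.+1 - chebU r :> {poly F} by [].
rewrite hornerD hornerN hornerM hornerZ hornerX !IHr // VS /t !exprS.
by field; rewrite two_neq0 s_neq0 expf_neq0.
Qed.

(** The subtracted 1 is built into the start [T 0 = - 1]. *)
Lemma sum_chebU_eval m :
  \sum_(1 <= j < m.+1) (chebU j).[t] ^+ 2 - 1 = T m / s ^+ (2 * m).
Proof.
elim: m => [|m IHm]; first by rewrite big_geq // T0 sub0r divr1.
rewrite big_nat_recr // addrAC IHm TS chebU_eval mulnS mul2n -addnn !exprD !exprS.
by field; rewrite s_neq0 expf_neq0.
Qed.

Lemma Z_neq0 k : Z k != 0.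
Proof. by elim: k => [|k IHk]; rewrite ?Z0 ?oner_eq0 // ZS !mulf_neq0. Qed.

Lemma sum_fractions k :
  \sum_(i < k) T i.+2 / (V i.+2 * V i.+3) = S k / Z k.
Proof.
elim: k => [|k IHk]; first by rewrite big_ord0 S0 mul0r.
by rewrite big_ord_recr /= IHk ZS SS; field; rewrite !V_neq0 Z_neq0.
Qed.

Lemma rhs_eval k :
  (4%:R * t ^+ 3 * (chebU k.+2).[t] ^+ 2)^-1 *
  \sum_(1 <= i < k.+1)
     ((\sum_(1 <= j < (k.+2 - i).+1) (chebU j).[t] ^+ 2) - 1)
     / ((chebU (k.+2 - i)).[t] * (chebU (k.+2 - i).+1).[t])
  = 2%:R * (s ^+ 2) ^+ k.+4 * S k / (V k.+2 ^+ 2 * Z k).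
Proof.
have -> : \sum_(1 <= i < k.+1)
     ((\sum_(1 <= j < (k.+2 - i).+1) (chebU j).[t] ^+ 2) - 1)
     / ((chebU (k.+2 - i)).[t] * (chebU (k.+2 - i).+1).[t]) = s * (S k / Z k).
  (* The index [i] is replaced by [k - i], which turns [k.+2 - i] into [i.+2]. In each fraction the
     powers of [s] then cancel up to one factor [s]. *)
  rewrite -sum_fractions big_nat_rev big_add1 big_mkord mulr_sumr.
  apply: eq_bigr => i _.
  have -> : (k.+2 - (1 + k.+1 - i.+2) = i.+2)%N by have := ltn_ord i; lia.
  rewrite sum_chebU_eval !chebU_eval mul2n -addnn exprD [s ^+ i.+3]exprS.
  by field; rewrite !V_neq0 s_neq0 expf_neq0.
have four_neq0 : 4%:R != 0 :> F by rewrite (natrM _ 2 2) mulf_neq0.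
(* The exponent of [s] is 3 from [t ^+ 3], [2 * (k + 2)] from the squared Chebyshev value and 1 from
   the sum, in all [2 * (k + 4)]; the constant is [8 / 4 = 2]. *)
rewrite chebU_eval /t (_ : (s ^+ 2) ^+ k.+4 = (s ^+ k.+2) ^+ 2 * s ^+ 4).
  by field; rewrite two_neq0 four_neq0 V_neq0 Z_neq0 s_neq0 expf_neq0.
by rewrite -!exprM -exprD; congr (_ ^+ _); lia.
Qed.

End Evaluation.

Theorem theorem5p13 (k : nat) (hk : (1 <= k)%N) :
  has_expansion
    ((4%:R * tcheb ^+ 3 * (chebU k).[tcheb] ^+ 2)^-1 *
     \sum_(1 <= i < (k - 2).+1)
        ((\sum_(1 <= j < (k - i).+1) (chebU j).[tcheb] ^+ 2) - 1)
        / ((chebU (k - i)).[tcheb] * (chebU (k - i).+1).[tcheb]))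
    (fun n : nat => (phi (idpat k) n)%:R).
Proof.
case: k hk => [|[|k]] // _.
  (* For [k] equal to 1 or 2 the outer sum is empty and no permutation qualifies, so both sides are
     0. *)
  exists 0, 1; split=> [||n].
  - by rewrite coef1 oner_eq0.
  - by rewrite big_geq // poly_in_x0 mulr0 mul0r.
  rewrite coef0 big1 // => i _.
  by rewrite phi_nwords nwords1_small // mulr0.
(* Numerator and denominator are those of [ser_phi]; the denominator has constant term 1. *)
exists (2%:R * 'X^(k.+4) * num k), (chebV k.+2 ^+ 2 * den k); split=> [||n].
- by rewrite coef0M expr2 coef0M !coef0_chebV coef0_den !mulr1 oner_eq0.
- have -> : poly_in_x (2%:R * 'X^(k.+4) * num k) =
             2%:R * (sqrtx ^+ 2) ^+ k.+4 * poly_in_x (num k).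
    by rewrite 2!poly_in_xM -poly_in_xX /poly_in_x !rmorph_nat !rmorphXn.
  have -> : poly_in_x (chebV k.+2 ^+ 2 * den k) =
             poly_in_x (chebV k.+2) ^+ 2 * poly_in_x (den k).
    by rewrite poly_in_xM /poly_in_x !rmorphXn.
  rewrite subn2.
  apply: (@rhs_eval _ _ (poly_in_x \o chebV) (poly_in_x \o sqsum) (poly_in_x \o den)
            (poly_in_x \o num)).
  + by rewrite -(rmorph_nat (@tofrac _)) tofrac_eq0 -polyC1 -polyCMn polyC_eq0.
  + exact: sqrtx_neq0.
  + by move=> r; rewrite poly_in_x_neq0 // coef0_chebV oner_eq0.
  + exact: poly_in_x1.
  + exact: poly_in_x1.
  + by move=> j; rewrite -poly_in_xX /comp -poly_in_xM -poly_in_xB.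
  + by rewrite /comp -poly_in_x1 -[RHS]sub0r -poly_in_x0 -poly_in_xB sub0r.
  + by move=> j; rewrite /comp -poly_in_xX expr2 -!poly_in_xM -poly_in_xD -expr2.
  + exact: poly_in_x1.
  + by move=> j; rewrite /comp -!poly_in_xM.
  + exact: poly_in_x0.
  + by move=> j; rewrite /comp -!poly_in_xM -poly_in_xD.
(* The coefficient of [x ^+ n] is already determined modulo [x ^+ n.+1], so the truncation order is
   taken to be [n]. *)
have eq_n := ser_phi n k; rewrite /ser -rmorphM in eq_n.
have := (in_qpolyXn_eqP n _ _).1 eq_n n (leqnn n); rewrite coefM => <-.
apply: eq_bigr => i _; rewrite coef_ser_poly ?leq_subr // phi_nwords.
by [].
Qed.
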